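(* Let $X$ be a Banach space and assume that $A\subseteq X$ is bounded and convex. Then $\mathrm{SCD}(A)$ is convex and closed (relative to $A$). Moreover, if $A$ is balanced, then so is $\mathrm{SCD}(A)$.
   Context: Banach spaces are over $\mathbb{K}=\mathbb{R}$ or $\mathbb{C}$; $X^*$ denotes the topological dual of $X$. A slice of a bounded set $A\subseteq X$ is a non-empty intersection of $A$ with an open half-space; it can be written as $S(A,x^*,\alpha)=\{x\in A:\operatorname{Re}x^*(x)>\sup_{b\in A}\operatorname{Re}x^*(b)-\alpha\}$ with $x^*\in X^*$, $\alpha>0$. Let $A\subseteq X$ be bounded and convex and $a\in A$. A countable collection $\{V_n:n\in\mathbb{N}\}$ of non-empty subsets of $A$ is determining for $a$ if $a\in\overline{\mathrm{conv}}(B)$ whenever $B\subseteq A$ intersects all the sets $V_n$. The point $a$ is an SCD point (slicely countably determined point) of $A$ if there is a sequence of slices of $A$ that is determining for $a$; $\mathrm{SCD}(A)$ is the set of all SCD points of $A$. A set $A$ is balanced if $\lambda A\subseteq A$ for every scalar $\lambda\in\mathbb{K}$ with $|\lambda|\le1$. *)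

(* Defs.v *)
From HB Require Import structures.
From mathcomp Require Import all_boot all_order all_algebra.
From mathcomp Require Import all_classical all_reals all_analysis.
From mathcomp.real_closed Require Import complex.

Set Implicit Arguments.
Unset Strict Implicit.
Unset Printing Implicit Defensive.

Import Order.TTheory GRing.Theory Num.Theory.
Import numFieldNormedType.Exports.

Local Open Scope classical_set_scope.
Local Open Scope ring_scope.

(* [scalar_field R K] has an element exactly when the field [K] is the real
   field [R] or the complex field [R[i]]. *)
Variant scalar_field (R : realType) : numFieldType -> Type :=
| RealScalars : scalar_field R R
| ComplexScalars : scalar_field R R[i].

Definition scalar_re (R : realType) (K : numFieldType)
    (k : scalar_field R K) : K -> R :=
  match k in scalar_field _ K' return K' -> R with
  | RealScalars => fun x => x
  | ComplexScalars => fun z => complex.Re z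
  end.

(* The coefficients range over [{i01 K}], the interval [0, 1] of [K]. For
   [K = R[i]] the order of [K] makes these the usual real coefficients. *)
Definition convex_hull (K : numFieldType) (X : normedModType K)
    (B : set X) : set X :=
  smallest (fun C : set X => convex_set (C : set (convex_lmodType X))) B.

Definition balanced (K : numFieldType) (X : normedModType K)
    (A : set X) : Prop :=
  forall l : K, `|l| <= 1 -> [set l *: x | x in A] `<=` A.

Section SliceCountableDetermination.
Variables (R : realType) (K : numFieldType) (k : scalar_field R K).
Variable X : normedModType K.

Definition slice (A : set X) (f : X -> K) (alpha : R) : set X :=
  [set x | A x /\
    scalar_re k (f x) > sup [set scalar_re k (f b) | b in A] - alpha].

Definition is_slice (A S : set X) : Prop :=
  S !=set0 /\
  exists (f : {linear X -> K^o}) (alpha : R),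
    [/\ continuous f, 0 < alpha & S = slice A f alpha].

Definition determining (A : set X) (V : nat -> set X) (a : X) : Prop :=
  (forall n, V n !=set0 /\ V n `<=` A) /\
  forall B : set X, B `<=` A -> (forall n, B `&` V n !=set0) ->
    closure (convex_hull B) a.

Definition SCD (A : set X) : set X :=
  [set a | A a /\
    exists V : nat -> set X,
      (forall n, is_slice A (V n)) /\ determining A V a].

End SliceCountableDetermination.

(* Main.v *)
Require Import Defs.
From HB Require Import structures.
From mathcomp Require Import all_boot all_order all_algebra.
From mathcomp Require Import all_classical all_reals all_analysis.
From mathcomp.real_closed Require Import complex.

Set Implicit Arguments.
Unset Strict Implicit.
Unset Printing Implicit Defensive.

Import Order.TTheory GRing.Theory Num.Theory.
Import numFieldNormedType.Exports.

Local Open Scope classical_set_scope.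
Local Open Scope ring_scope.

(** A sequence [V] determines [a] exactly when [a] belongs to every closed
    convex set containing some [B] in [A] that meets all the [V n]. So if
    countably many points [a n] are determined by sequences of slices, the
    (still countable) union of these sequences determines every point of [A]
    in the closed convex hull of the [a n] ([SCD_closed_hull]). Two points
    [a n] give the convexity of the SCD set. A sequence [a n] converging to a
    point gives its closedness; such a sequence exists because the scalar field
    is archimedean, so that the balls of radius [1 / (n + 1)] form a basis of
    neighborhoods.

    Let [A] be balanced. Multiplication by a scalar [m] of modulus 1 is then a
    linear homeomorphism that maps [A] onto [A] and slices of [A] to slices of
    [A], hence SCD points to SCD points ([SCD_rotate]). Every scalar [l] with
    [`|l| <= 1] has the form [`|l| * m] with [`|m| = 1], and [`|l| * m] is a
    convex combination of [m] and [- m]; so the convexity of the SCD set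
    finishes the proof. *)

Lemma convex_setP (K : numFieldType) (X : normedModType K) (C : set X) :
  convex_set (C : set (convex_lmodType X)) <->
  forall (x y : X) (t : K), 0 <= t -> t <= 1 -> C x -> C y ->
    C (t *: x + (1 - t) *: y).
Proof.
split=> [cC x y t t0 t1 Cx Cy|cC x y t /set_mem Cx /set_mem Cy].
  by have /set_mem := cC x y (Itv01 t0 t1) (mem_set Cx) (mem_set Cy).
by apply/mem_set/cC.
Qed.

Lemma closure_sub_closed (T : topologicalType) (B D : set T) :
  closed D -> B `<=` D -> closure B `<=` D.
Proof. by move=> cD BD; rewrite [D](closure_id D).1//; exact: closureS. Qed.

Lemma closed_preimage_affine (K : numFieldType) (X : normedModType K)
    (D : set X) (s : K) (a : X) :
  closed D -> closed [set x | D (s *: x + a)].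
Proof.
move=> cD; have /continuous_closedP/(_ _ cD)// :
  continuous (fun x : X => s *: x + a).
by move=> x; apply: cvgD; [exact: scaler_continuous|exact: cvg_cst].
Qed.

(** Convexity passes to the closure in one end point at a time: with the other
    end point and the weight fixed, the end points for which the combination
    falls in the closure form the preimage of a closed set under an affine
    map. *)
Lemma convex_closure (K : numFieldType) (X : normedModType K) (C : set X) :
  convex_set (C : set (convex_lmodType X)) ->
  convex_set (closure C : set (convex_lmodType X)).
Proof.
move=> /convex_setP cC; apply/convex_setP => x y t t0 t1 Cx Cy.
have closed_line s (a : X) := @closed_preimage_affine _ _ _ s a (@closed_closure _ C).
have {Cy} half c : C c -> closure C (t *: c + (1 - t) *: y).
  move=> Cc; rewrite addrC.
  apply: (closure_sub_closed (closed_line (1 - t) (t *: c)) _ Cy) => z Cz /=.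
  by rewrite addrC; apply: subset_closure; exact: cC.
exact: (closure_sub_closed (closed_line t ((1 - t) *: y)) half Cx).
Qed.

Lemma convex_convex_hull (K : numFieldType) (X : normedModType K) (B : set X) :
  convex_set (convex_hull B : set (convex_lmodType X)).
Proof.
apply/convex_setP => x y t t0 t1 Bx By C CB; have /convex_setP cC := CB.1.
by apply: cC => //; [exact: Bx|exact: By].
Qed.

Lemma sub_convex_hull (K : numFieldType) (X : normedModType K) (B : set X) :
  B `<=` convex_hull B.
Proof. exact: sub_gen_smallest. Qed.

Lemma closed_hull_sub (K : numFieldType) (X : normedModType K) (B C : set X) :
  closed C -> convex_set (C : set (convex_lmodType X)) -> B `<=` C ->
  closure (convex_hull B) `<=` C.
Proof.
by move=> cC vC BC; apply: closure_sub_closed => //; exact: smallest_sub.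
Qed.

(** One enumeration of [nat * nat] merges the sequences that determine the
    [a n] into a single sequence. *)
Lemma SCD_closed_hull (R : realType) (K : numFieldType) (k : scalar_field R K)
    (X : normedModType K) (A : set X) (a : nat -> X) (x : X) :
  (forall n, SCD k A (a n)) -> A x -> closure (convex_hull (range a)) x ->
  SCD k A x.
Proof.
move=> SCDa Ax ax; split=> //.
have /choice[V VP] n := (SCDa n).2.
pose ij (n : nat) := odflt (0, 0)%N (unpickle n : option (nat * nat)).
exists (fun n => V (ij n).1 (ij n).2); split=> [n|].
  exact: (VP _).1.
split=> [n|B BA BV]; first exact: (VP _).2.1.
apply: closed_hull_sub ax.
- exact: closed_closure.
- exact/convex_closure/convex_convex_hull.
- move=> _ [i _ <-]; apply: (VP i).2.2 => // j.
  by have := BV (pickle (i, j)); rewrite /ij pickleK.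
Qed.

Lemma SCD_convex (R : realType) (K : numFieldType) (k : scalar_field R K)
    (X : normedModType K) (A : set X) :
  convex_set (A : set (convex_lmodType X)) ->
  convex_set (SCD k A : set (convex_lmodType X)).
Proof.
move=> /convex_setP cA; apply/convex_setP => x y t t0 t1 Sx Sy.
pose a n := if n is 0%N then x else y.
apply: (@SCD_closed_hull _ _ _ _ _ a) => [[|n]//||].
  by apply: cA; [| |exact: Sx.1|exact: Sy.1].
have /convex_setP cH := @convex_convex_hull _ _ (range a).
have aH n : convex_hull (range a) (a n) := sub_convex_hull (imageT a n).
by apply: subset_closure; exact: cH t0 t1 (aH 0%N) (aH 1%N).
Qed.

(** A positive complex number is real, so the archimedean property of [R] also
    serves [R[i]]. *)
Lemma scalar_field_archi (R : realType) (K : numFieldType)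
    (k : scalar_field R K) (e : K) :
  0 < e -> exists n, n.+1%:R^-1 < e.
Proof.
have archiR (r : R) : 0 < r -> exists n, n.+1%:R^-1 < r.
  move=> r0; have [N _ /(_ N (leqnn N))] := near_infty_natSinv_lt (PosNum r0).
  by exists N.
case: k e => [|[r i]]; first exact: archiR.
rewrite ltcE/= => /andP[/eqP -> /archiR[n nr]]; exists n.
suff -> : n.+1%:R^-1 = (n.+1%:R^-1)%:C%C :> R[i] by rewrite ltcR.
by rewrite fmorphV rmorph_nat.
Qed.

Lemma SCD_closed (R : realType) (K : numFieldType) (k : scalar_field R K)
    (X : normedModType K) (A : set X) :
  closed (SCD k A : set (subspace A)).
Proof.
apply/closed_subspaceP; exists (closure (SCD k A : set X)).
  exact: closed_closure.
rewrite eqEsubset; split=> x [Sx Ax]; split=> //; last exact: subset_closure.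
have /choice[a aP] (n : nat) : exists y, SCD k A y /\ ball x n.+1%:R^-1 y.
  by apply: Sx; apply: nbhsx_ballx; rewrite invr_gt0.
apply: (@SCD_closed_hull _ _ _ _ _ a) => [n||]//; first exact: (aP n).1.
move=> U /nbhs_ballP[e /= e0 eU].
have [n ne] := scalar_field_archi k e0.
exists (a n); split; first exact: (sub_convex_hull (imageT a n)).
by apply: eU; apply: le_ball (aP n).2; exact: ltW.
Qed.

Lemma balanced_scale (K : numFieldType) (X : normedModType K) (A : set X)
    (m : K) (x : X) :
  balanced A -> `|m| = 1 -> A x -> A (m *: x).
Proof. by move=> bA m1 Ax; apply: (bA m); [rewrite m1|exists x]. Qed.

Lemma normV_eq1 (K : numFieldType) (m : K) : `|m| = 1 -> `|m^-1| = 1.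
Proof. by move=> m1; rewrite normfV m1 invr1. Qed.

(** The rotated slice is cut out by the functional [x |-> f (m^-1 *: x)]. Its
    supremum over [A] is that of [f], because [m^-1 *: A = A]. *)
Lemma slice_rotate (R : realType) (K : numFieldType) (k : scalar_field R K)
    (X : normedModType K) (A : set X) (f : X -> K) (alpha : R) (m : K) :
  balanced A -> `|m| = 1 ->
  [set m *: x | x in slice k A f alpha] =
  slice k A (f \o *:%R m^-1) alpha.
Proof.
move=> bA m1; have mV1 := normV_eq1 m1.
have m0 : m != 0 by rewrite -normr_eq0 m1 oner_neq0.
have supE : [set scalar_re k ((f \o *:%R m^-1) b) | b in A] =
            [set scalar_re k (f b) | b in A].
  rewrite eqEsubset; split=> _ [b Ab <-].
    by exists (m^-1 *: b) => //; exact: balanced_scale.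
  by exists (m *: b); [exact: balanced_scale|rewrite /= scalerK].
rewrite /slice supE eqEsubset; split=> [_ [x [Ax fx] <-]|x [Ax fx]].
  by split; [exact: balanced_scale|rewrite /= scalerK].
by exists (m^-1 *: x); [split=> //; exact: balanced_scale|rewrite scalerKV].
Qed.

Lemma is_slice_rotate (R : realType) (K : numFieldType) (k : scalar_field R K)
    (X : normedModType K) (A S : set X) (m : K) :
  balanced A -> `|m| = 1 -> is_slice k A S ->
  is_slice k A [set m *: x | x in S].
Proof.
move=> bA m1 [S0 [f [alpha [cf alpha0 SE]]]]; split; first exact: image_nonempty.
exists (f \o *:%R m^-1 : {linear X -> K^o}), alpha; split=> //.
  move=> x; apply: (@continuous_comp _ _ _ ( *:%R m^-1) f).
    exact: scaler_continuous.
  exact: cf.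
by rewrite SE slice_rotate.
Qed.

Lemma SCD_rotate (R : realType) (K : numFieldType) (k : scalar_field R K)
    (X : normedModType K) (A : set X) (m : K) (a : X) :
  balanced A -> `|m| = 1 -> SCD k A a -> SCD k A (m *: a).
Proof.
move=> bA m1 [Aa [V [sV [VA detV]]]]; have mV1 := normV_eq1 m1.
have m0 : m != 0 by rewrite -normr_eq0 m1 oner_neq0.
split; first exact: balanced_scale.
exists (fun n => [set m *: x | x in V n]); split=> [n|].
  exact: is_slice_rotate.
split=> [n|B BA BV].
  split; first exact/image_nonempty/(VA n).1.
  by move=> _ [x /(VA n).2 Ax <-]; exact: balanced_scale.
have : closure (convex_hull [set m^-1 *: x | x in B]) a.
  apply: detV => [_ [x /BA Ax <-]|n]; first exact: balanced_scale.
  have [y [By [x Vx yE]]] := BV n; rewrite -yE in By.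
  by exists x; split=> //; exists (m *: x); rewrite ?scalerK.
have /convex_setP cB := convex_closure (@convex_convex_hull _ _ B).
apply: (@closed_hull_sub _ _ _ [set x | closure (convex_hull B) (m *: x)]).
- under eq_fun do rewrite -[m *: _]addr0.
  by apply: closed_preimage_affine; exact: closed_closure.
- apply/convex_setP => x y t t0 t1 Bx By /=.
  by rewrite scalerDr !scalerA ![m * _]mulrC -!scalerA; exact: cB.
- move=> _ [x Bx <-] /=; rewrite scalerKV//.
  exact: subset_closure (sub_convex_hull Bx).
Qed.

Lemma SCD_balanced (R : realType) (K : numFieldType) (k : scalar_field R K)
    (X : normedModType K) (A : set X) :
  convex_set (A : set (convex_lmodType X)) ->
  balanced A -> balanced (SCD k A).
Proof.
move=> /(@SCD_convex _ _ k)/convex_setP cS bA l l1 _ [a Sa <-].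
have [m m1 lE] : exists2 m : K, `|m| = 1 & l = `|l| * m.
  have [->|l0] := eqVneq l 0; first by exists 1; rewrite ?normr1// normr0 mul0r.
  exists (l / `|l|); last by rewrite mulrC divfK// normr_eq0.
  by rewrite normrM normfV normr_id divff// normr_eq0.
(* The weight [t] of [m] against [- m] solves [t - (1 - t) = `|l|]. *)
pose t : K := (1 + `|l|) / 2.
have -> : l *: a = t *: (m *: a) + (1 - t) *: (- m *: a).
  rewrite !scalerA -scalerDl {1}lE mulrN -mulNr -mulrDl opprB.
  by rewrite addrA /t -splitr addrAC subrr add0r.
apply: cS.
- by rewrite divr_ge0// addr_ge0.
- by rewrite ler_pdivrMr// mul1r -[2]/(1 + 1) lerD2l.
- exact: SCD_rotate.
- by apply: SCD_rotate; rewrite ?normrN.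
Qed.

Theorem lemma2p6 (R : realType) (K : numFieldType) (k : scalar_field R K)
    (X : completeNormedModType K) (A : set X) :
  bounded_set A ->
  convex_set (A : set (convex_lmodType X)) ->
  [/\ convex_set (SCD k A : set (convex_lmodType X)),
      closed (SCD k A : set (subspace A)) &
      (balanced A -> balanced (SCD k A))].
Proof.
move=> _ cA; split.
- exact: SCD_convex.
- exact: SCD_closed.
- exact: SCD_balanced.
Qed.
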